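(* Let $\Gamma$ be a finite non-trivial abelian group, and let $k$ be the number of elementary divisors of $\Gamma$ (counted with multiplicity). Then $\operatorname{fix}(\Gamma)=\{1,\ldots,k\}$.
   Context: Graphs are finite, undirected and simple (not necessarily connected). For a graph $G$ and $S\subseteq V(G)$, $\operatorname{stab}(S)=\{g\in\operatorname{Aut}(G) : g(v)=v \text{ for all } v\in S\}$. The set $S$ is a fixing set of $G$ if $\operatorname{stab}(S)$ is trivial. The fixing number $\operatorname{fix}(G)$ is the smallest cardinality of a fixing set of $G$. For a finite group $\Gamma$, the fixing set of $\Gamma$ is $\operatorname{fix}(\Gamma)=\{\operatorname{fix}(G) : G \text{ is a finite graph with } \operatorname{Aut}(G)\cong\Gamma\}$. The elementary divisors of a finite abelian group $\Gamma$ are the prime powers $p^{\alpha}$ ($\alpha\ge 1$) that are the orders of the cyclic factors in the (unique up to reordering) decomposition of $\Gamma$ as a direct product of cyclic groups of prime power order, listed with multiplicity. *)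

(* Defs.v *)
From HB Require Import structures.
From mathcomp Require Import all_boot all_fingroup all_solvable.

Set Implicit Arguments.
Unset Strict Implicit.
Unset Printing Implicit Defensive.

Record sgraph := SGraph {
  vertex :> finType;
  adj : rel vertex;
  adj_sym : symmetric adj;
  adj_irr : irreflexive adj }.

Section FixingNumber.

Variable G : sgraph.
Implicit Types S : {set G}.

Definition graph_aut : {set {perm G}} :=
  [set g : {perm G} | [forall x, forall y, adj (g x) (g y) == adj x y]].

Lemma graph_aut_group_set : group_set graph_aut.
Proof.
apply/group_setP; split=> [|g h].
  by rewrite inE; apply/forallP=> x; apply/forallP=> y; rewrite !perm1.
rewrite !inE => /forallP Ag /forallP Ah.
apply/forallP=> x; apply/forallP=> y; rewrite !permM.
by rewrite (eqP (forallP (Ah _) _)) (eqP (forallP (Ag _) _)).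
Qed.

Canonical graph_aut_group := Group graph_aut_group_set.

(* 'C_(A)(S | 'P) is the pointwise stabiliser of S in A, not the setwise one. *)
Definition stab S : {set {perm G}} := ('C_(graph_aut)(S | 'P))%g.

Definition is_fixing_set S : bool := stab S == 1%g.

(* [set: G] is always a fixing set (fixing_setT), so the default value of     *)
(* arg min is never used spuriously.                                          *)
Definition fixing_number : nat :=
  #|[arg min_(S < [set: G] | is_fixing_set S) #|S| ]|.

Lemma fixing_setT : is_fixing_set [set: G].
Proof.
apply/eqP/trivgP/subsetP=> g; rewrite inE => /andP[_] /astabP fixg.
by rewrite inE; apply/eqP/permP=> x; rewrite perm1; apply: fixg.
Qed.

Lemma fixing_numberP :
  (exists2 S, is_fixing_set S & #|S| = fixing_number) /\
  (forall S, is_fixing_set S -> fixing_number <= #|S|).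
Proof.
rewrite /fixing_number; case: arg_minnP => [|S fixS minS].
  exact: fixing_setT.
by split; [exists S | exact: minS].
Qed.

End FixingNumber.

(* The set fix(Gamma) of natural numbers, as a predicate on nat.              *)
Definition in_group_fix (gT : finGroupType) (Gamma : {group gT}) (n : nat) : Prop :=
  exists2 G : sgraph, graph_aut G \isog Gamma & fixing_number G = n.

Definition prime_power (q : nat) : Prop :=
  exists p a, [/\ prime p, 0 < a & q = p ^ a].

(* s lists, in some order, the orders of the cyclic factors of an internal    *)
(* direct decomposition of Gamma into cyclic groups of prime power order; for *)
(* abelian Gamma such an s exists and is unique up to permutation (below).    *)
Definition elementary_divisors (gT : finGroupType) (Gamma : {group gT})
    (s : seq nat) : Prop :=
  exists b : seq gT,
    [/\ (\big[dprod/1]_(x <- b) <[x]> = Gamma)%g,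
        s = [seq #[x]%g | x <- b]
      & forall q, q \in s -> prime_power q].

Lemma elementary_divisors_exist (gT : finGroupType) (Gamma : {group gT}) :
  abelian Gamma -> exists s, elementary_divisors Gamma s.
Proof.
have [n] := ubnP #|Gamma|; elim: n Gamma => // n IHn A /ltnSE leAn abA.
have [A1 | ntA] := eqVneq (A : {set gT}) 1%g.
  by exists [::], [::]; split=> //; rewrite big_nil A1.
pose p := pdiv #|A|; have p_pr : prime p by rewrite pdiv_prime ?cardG_gt1.
have [pA | npA] := boolP (p.-group A)%g.
  have [b defA ordb] := abelian_structure abA.
  exists [seq #[x]%g | x <- b], b; split=> // q q_b.
  have q_gt1: 1 < q.
    by move: q_b; rewrite ordb => /(allP (abelian_type_gt1 A)).
  case/mapP: q_b => x b_x Dq.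
  have Ax: x \in A.
    have sxA: <[x]>%g \subset A.
      rewrite -(bigdprodWY defA) (big_rem x) //= sub_gen ?subsetUl //.
    by rewrite -cycle_subG.
  have [a Da] := p_natP (mem_p_elt pA Ax).
  exists p, a; split; rewrite ?Dq //.
  by rewrite lt0n; apply: contraTneq q_gt1 => a0; rewrite Dq Da a0.
have defA := nilpotent_pcoreC p (abelian_nil abA).
have oA := dprod_card defA.
have [p1 q1] : 1 < #|'O_p(A)%g| /\ 1 < #|'O_(p^')(A)%g|.
  have Hp: p \in \pi(#|A|) by rewrite pi_pdiv cardG_gt1.
  split; rewrite ltn_neqAle cardG_gt0 andbT eq_sym; apply/eqP=> o1.
    have := pcore_pgroup p^' A; rewrite /pgroup.
    move: oA; rewrite o1 mul1n => ->.
    by rewrite p'natE // (dvdn_trans (pdiv_dvd _) _).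
  case/negP: npA; move: oA; rewrite o1 muln1 => oA.
  by rewrite /pgroup -oA; apply: pcore_pgroup.
have [s1 [b1 [d1 e1 pp1]]] : exists s, elementary_divisors 'O_p(A)%G s.
  apply: IHn; last exact: abelianS (pcore_sub _ _) abA.
  by apply: leq_trans leAn; rewrite -oA ltn_Pmulr.
have [s2 [b2 [d2 e2 pp2]]] : exists s, elementary_divisors 'O_(p^')(A)%G s.
  apply: IHn; last exact: abelianS (pcore_sub _ _) abA.
  by apply: leq_trans leAn; rewrite -oA ltn_Pmull.
exists (s1 ++ s2), (b1 ++ b2); split.
- by rewrite big_cat /= d1 d2.
- by rewrite e1 e2 map_cat.
- by move=> q; rewrite mem_cat => /orP[/pp1 | /pp2].
Qed.

Lemma elementary_divisors_unique (gT : finGroupType) (Gamma : {group gT}) s1 s2 :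
  elementary_divisors Gamma s1 -> elementary_divisors Gamma s2 -> perm_eq s1 s2.
Proof.
have cnt p a s : prime p -> elementary_divisors Gamma s ->
    count_mem (p ^ a.+1) s + logn p #|'Ohm_a.+2(Gamma) : 'Ohm_a.+1(Gamma)|%g
      = logn p #|'Ohm_a.+1(Gamma) : 'Ohm_a(Gamma)|%g.
  move=> p_pr [b [defG -> ppb]]; rewrite -!(count_logn_dprod_cycle _ _ defG).
  elim: b {defG} ppb => //= x b IHb ppb.
  rewrite -IHb => [|q b_q]; last by apply: ppb; rewrite inE b_q orbT.
  rewrite addnACA; congr (_ + _)%N.
  have [|r [c [r_pr c_gt0 ->]]] := ppb #[x]%g; first exact: mem_head.
  rewrite lognX logn_prime //; have [-> | neq_pr] := eqVneq p r.
    by rewrite muln1 eqn_exp2l ?prime_gt1 //; case: ltngtP.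
  rewrite muln0 !ltn0 addn0; apply/eqP; rewrite eqb0; apply: contra neq_pr => /eqP Drc.
  have: p %| r ^ c by rewrite Drc dvdn_exp.
  by rewrite Euclid_dvdX // dvdn_prime2 // => /andP[].
move=> Es1 Es2; apply/allP=> q _ /=; apply/eqP.
have [s1q | /count_memPn n1] := boolP (q \in s1).
  have [b [_ _ /(_ q s1q) [p [[|a] [p_pr // _ ->]]]]] := Es1.
  by apply/eqP; rewrite -(eqn_add2r (logn p #|'Ohm_a.+2(Gamma) : 'Ohm_a.+1(Gamma)|%g)) !cnt.
have [s2q | /count_memPn n2] := boolP (q \in s2); last by rewrite n1 n2.
have [b [_ _ /(_ q s2q) [p [[|a] [p_pr // _ ->]]]]] := Es2.
by apply/eqP; rewrite -(eqn_add2r (logn p #|'Ohm_a.+2(Gamma) : 'Ohm_a.+1(Gamma)|%g)) !cnt.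
Qed.

(* Main.v *)
(* Upper bound: if A is the automorphism group and E = 'Ohm_1(A) is generated *)
(* by the elements of prime order, then |E| is a product of k primes, one per *)
(* elementary divisor.  A greedily chosen base of E has at most k points, and *)
(* a stabiliser in A that meets E trivially is trivial.                       *)
(*   Realisation of n <= k: group the elementary divisors into n blocks, so   *)
(* that Gamma is the direct product of nontrivial groups K_1, ..., K_n.       *)
(* Colour the pairs of points of n disjoint copies of the ambient group so    *)
(* that the colour-preserving permutations are exactly the independent        *)
(* translations of the i-th copy by K_i; a base must then meet every copy.    *)
(* Any such coloured structure becomes a graph with an isomorphic group and   *)
(* the same bases: take several copies of the point set to encode the         *)
(* colours, and recognise each copy by its number of neighbours in a set of   *)
(* reference vertices that every automorphism fixes.                          *)

Require Import Defs.
From mathcomp Require Import all_boot all_fingroup all_solvable.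

Set Implicit Arguments.
Unset Strict Implicit.
Unset Printing Implicit Defensive.

Import GroupScope.

(** For the upper bound, [small_base] is applied to ['Ohm_1] of the automorphism group, since the
    order of the full group may have more than k prime factors. For the realisation,
    [elementary_divisors_blocks] supplies n nontrivial direct factors, [block_colour_aut_isog]
    realises their product by a colouring, and [fixing_number_colour_graph] carries the base size
    over to a graph. *)

(** * Bounds on the fixing number *)

Lemma prime_dvd_prod_mem p (qs : seq nat) :
  prime p -> all prime qs -> p %| \prod_(q <- qs) q -> p \in qs.
Proof.
move=> p_pr; elim: qs => [|q qs IHqs] /=.
  by rewrite big_nil dvdn1 => _ /eqP p1; rewrite p1 in p_pr.
case/andP=> q_pr pr_qs; rewrite big_cons Euclid_dvdM // dvdn_prime2 // inE.
by case/orP=> [-> // | /(IHqs pr_qs) ->]; rewrite orbT.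
Qed.

(* Each new point moved by the current pointwise stabiliser removes at least  *)
(* one prime factor from its order.                                           *)
Lemma small_base (T : finType) (H : {group {perm T}}) (qs : seq nat) :
    all prime qs -> (#|H| %| \prod_(q <- qs) q)%N ->
  exists2 S : {set T}, #|S| <= size qs & 'C_H(S | 'P) = 1.
Proof.
have [m] := ubnP (size qs); elim: m H qs => // m IHm H qs le_qs pr_qs dvH.
have [H1 | ntH] := eqVneq (H : {set _}) 1.
  by exists set0; rewrite ?cards0 // H1; apply/setIidPl/sub1G.
have [v /existsP[h /andP[Hh hv]]] : exists v, [exists h in H, h v != v].
  have [h Hh nth] := trivgPn _ ntH; apply/existsP; apply: contraR nth.
  rewrite negb_exists => /forallP fixh; apply/eqP/permP=> v; rewrite perm1.
  by have := fixh v; rewrite negb_exists => /forallP/(_ h); rewrite Hh negbK => /eqP.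
pose C := 'C_H[v | 'P]%G.
have ltCH: C \proper H.
  rewrite properEneq subsetIl andbT; apply: contra hv => /eqP eqCH.
  by have := Hh; rewrite -eqCH inE => /andP[_ /astab1P/= fixh]; apply/eqP.
have ind_gt1: 1 < #|H : C| by rewrite indexg_gt1 proper_subn.
pose p := pdiv #|H : C|; have p_pr : prime p by apply: pdiv_prime.
have dvCp: (p * #|C| %| \prod_(q <- qs) q)%N.
  apply: dvdn_trans dvH; rewrite -(Lagrange (proper_sub ltCH)) mulnC.
  by rewrite dvdn_pmul2l ?pdiv_dvd.
have p_qs : p \in qs.
  by apply: prime_dvd_prod_mem => //; apply: dvdn_trans dvCp; apply: dvdn_mulr.
have [|||S leS CS] := IHm C (rem p qs).
- by rewrite size_rem //; case: (qs) p_qs le_qs.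
- by apply/allP=> q /mem_rem; apply: (allP pr_qs).
- by move: dvCp; rewrite (big_rem p) //= dvdn_pmul2l ?prime_gt0.
exists (v |: S).
  rewrite cardsU1 (leq_trans (leq_add (leq_b1 _) leS)) // size_rem //.
  by case: (qs) p_qs.
by rewrite astabU setIA.
Qed.

(** ['Ohm_1] commutes with direct products, and in a nontrivial cyclic p-group it has order p. *)
Lemma card_Ohm1_bigdprod (gT : finGroupType) (b : seq gT) (G : {group gT}) :
    \big[dprod/1]_(x <- b) <[x]> = G ->
    (forall x, x \in b -> prime_power #[x]) ->
  exists qs, [/\ all prime qs, size qs = size b & #|'Ohm_1(G)| = (\prod_(q <- qs) q)%N].
Proof.
elim: b G => [|x b IHb] G.
  rewrite !big_nil => <- _; exists [::]; split=> //.
  by rewrite big_nil; apply/eqP; rewrite -trivg_card1; apply/eqP/trivgP/Ohm_sub.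
rewrite big_cons => defG ppb; have [[_ H _ defH] _ _ _] := dprodP defG.
have [y b_y|qs [pr_qs sz_qs oH]] := IHb H defH.
  by apply: ppb; rewrite inE b_y orbT.
have [p [a [p_pr a_gt0 ox]]] := ppb x (mem_head _ _).
exists (p :: qs); rewrite /= p_pr sz_qs; split=> //.
rewrite defH in defG; rewrite -(dprod_card (Ohm_dprod 1 defG)) oH big_cons.
congr (_ * _)%N; apply: Ohm1_cyclic_pgroup_prime (cycle_cyclic x) _ _.
  by rewrite /pgroup -orderE ox pnatX pnat_id.
rewrite -cardG_gt1 -orderE ox; apply: leq_trans (prime_gt1 p_pr) _.
by rewrite -{1}(expn1 p) leq_exp2l ?prime_gt1.
Qed.

Lemma fixing_number_le (gT : finGroupType) (Gamma : {group gT}) s (G : sgraph) :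
    elementary_divisors Gamma s -> graph_aut G \isog Gamma ->
  fixing_number G <= size s.
Proof.
case=> b [defG -> ppb] isoG.
have [x b_x|qs [pr_qs sz_qs oE]] := card_Ohm1_bigdprod defG.
  exact/ppb/map_f.
have [|S leS CS] := @small_base G 'Ohm_1(graph_aut G) qs pr_qs.
  by rewrite -oE (card_isog (gFisog _ isoG)).
rewrite size_map -sz_qs; apply: leq_trans leS.
apply: (proj2 (fixing_numberP G)); apply/eqP.
(* By Cauchy, a nontrivial stabiliser would contain an element of prime order, and that element lies
   in ['Ohm_1]. *)
by rewrite /stab setIC; apply: TI_Ohm1; rewrite setIC.
Qed.

Lemma fixing_number_gt0 (gT : finGroupType) (Gamma : {group gT}) (G : sgraph) :
  Gamma :!=: 1 -> graph_aut G \isog Gamma -> 0 < fixing_number G.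
Proof.
move=> ntG isoG; rewrite lt0n; apply: contra ntG => /eqP fix0.
have [[S /eqP fixS cardS] _] := fixing_numberP G.
rewrite fix0 in cardS; rewrite (cards0_eq cardS) in fixS.
rewrite -(isog_eq1 isoG) -fixS eqEsubset [stab _]setIC subsetIr andbT.
by rewrite subsetI subxx andbT; apply/subsetP=> g _; apply/astabP=> x; rewrite inE.
Qed.

(** * Encoding a colouring of pairs as a graph *)

Section ColouringGraph.

Variables (T C : finType) (c : T -> T -> C) (t0 : T).

Definition colour_aut : {set {perm T}} :=
  [set f : {perm T} | [forall x, forall y, c (f x) (f y) == c x y]].

Lemma colour_autP (f : {perm T}) :
  reflect (forall x y, c (f x) (f y) = c x y) (f \in colour_aut).
Proof.
rewrite inE; apply: (iffP forallP) => [cf x y | cf x].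
  exact/eqP/(forallP (cf x)).
by apply/forallP=> y; rewrite cf.
Qed.

Lemma colour_aut_group_set : group_set colour_aut.
Proof.
apply/group_setP; split=> [|f h /colour_autP cf /colour_autP ch].
  by apply/colour_autP=> x y; rewrite !perm1.
by apply/colour_autP=> x y; rewrite !permM ch cf.
Qed.

Canonical colour_aut_group := Group colour_aut_group_set.

(* [None] indexes a copy of [T] matched to every other copy; the arcs of      *)
(* colour [k] run from the copy [Some (k, false)] to [Some (k, true)].        *)
Let layer : finType := option (C * bool).

Let layer_le (l l' : layer) : bool := enum_rank l <= enum_rank l'.

(* On top of the copies of [T] there is one reference vertex per layer, with  *)
(* layer [l'] adjacent to the references [l <= l'], and two further vertices: *)
(* [inr (inr true)] is adjacent to the references, and [inr (inr false)],     *)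
(* pendant at it, is the only vertex of degree 1.                             *)
Let cvertex : finType := ((T * layer) + (layer + bool))%type.

(** Two copies per colour keep the graph simple although [c] may be asymmetric and also colours the
    diagonal. *)
Let layer_adj (u v : T * layer) : bool :=
  match u, v with
  | (x, None), (y, Some _) | (x, Some _), (y, None) => x == y
  | (x, Some (k, false)), (y, Some (k', true)) => (k == k') && (c x y == k)
  | (x, Some (k, true)), (y, Some (k', false)) => (k' == k) && (c y x == k')
  | _, _ => false
  end.

Let cadj (u v : cvertex) : bool :=
  match u, v with
  | inl u, inl v => layer_adj u v
  | inl (_, l'), inr (inl l) | inr (inl l), inl (_, l') => layer_le l l'
  | inr (inl _), inr (inr b) | inr (inr b), inr (inl _) => b
  | inr (inr b), inr (inr b') => b != b'
  | _, _ => false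
  end.

Let layer_adj_sym : symmetric layer_adj.
Proof. by move=> [x [[k []]|]] [y [[k' []]|]] //=; rewrite eq_sym. Qed.

Let cadj_sym : symmetric cadj.
Proof.
move=> [[x l]|[l|b]] [[y l']|[l'|b']] //=; last by rewrite eq_sym.
exact: (layer_adj_sym (x, l) (y, l')).
Qed.

Let cadj_irr : irreflexive cadj.
Proof. by move=> [[x [[k []]|]]|[l|b]] //=; rewrite eqxx. Qed.

Definition colour_graph : sgraph := SGraph cadj_sym cadj_irr.

Let lift_fun (f : T -> T) (v : colour_graph) : colour_graph :=
  if v is inl (x, l) then inl (f x, l) else v.

Let lift_fun_inj (f : {perm T}) : injective (lift_fun f).
Proof.
by move=> [[x l]|v] [[y l']|v'] //= [] // /perm_inj -> ->.
Qed.

Definition graph_lift (f : {perm T}) : {perm colour_graph} :=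
  perm (@lift_fun_inj f).

Let liftE f x l : graph_lift f (inl (x, l)) = inl (f x, l).
Proof. by rewrite permE. Qed.

Let liftE' f v : graph_lift f (inr v) = inr v.
Proof. by rewrite permE. Qed.

Lemma graph_liftM : {in setT &, {morph graph_lift : f h / f * h}}.
Proof.
by move=> f h _ _; apply/permP=> [[[x l]|v]]; rewrite permM ?liftE ?permM ?liftE'.
Qed.

Canonical graph_lift_morphism := Morphism graph_liftM.

Lemma graph_lift_inj : injective graph_lift.
Proof.
move=> f h /permP eqfh; apply/permP=> x.
by have := eqfh (inl (x, None)); rewrite !liftE => -[].
Qed.

Lemma graph_lift_aut f : f \in colour_aut -> graph_lift f \in graph_aut colour_graph.
Proof.
move/colour_autP=> cf; rewrite inE.
apply/forallP=> u; apply/forallP=> v; apply/eqP.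
case: u v => [[x l]|u] [[y l']|v]; rewrite ?liftE ?liftE' //=.
by case: l l' => [[k []]|] [[k' []]|] //=; rewrite ?(inj_eq perm_inj) ?cf.
Qed.

Section Automorphism.

Variable g : {perm colour_graph}.
Hypothesis aut_g : g \in graph_aut colour_graph.

Let gadj u v : cadj (g u) (g v) = cadj u v.
Proof. by move: aut_g; rewrite inE => /forallP/(_ u)/forallP/(_ v)/eqP. Qed.

Let layer_le_refl l : layer_le l l.
Proof. exact: leqnn. Qed.

Let pendant : colour_graph := inr (inr false).
Let top : colour_graph := inr (inr true).

Let nbr_pendant v : cadj pendant v = (v == top).
Proof. by case: v => [[x l]|[l|[]]]. Qed.

(** Every other vertex has two distinct neighbours; for a reference vertex one of them is the copy
    of [t0] in its layer. *)
Let pendant_unique u w : (forall v, cadj u v = (v == w)) -> u = pendant.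
Proof.
have two v v' : v != v' -> cadj u v -> cadj u v' ->
    (forall v, cadj u v = (v == w)) -> u = pendant.
  move=> neq_v uv uv' eqw; rewrite !eqw in uv uv'.
  by rewrite (eqP uv) (eqP uv') eqxx in neq_v.
move=> eqw; case: u two eqw => [[x l]|[l|[]]] two eqw //.
- apply: (two (inr (inl l)) (inl (x, if l is None then Some (c x x, true) else None))) => //=.
  by case: (l) => [[k []]|] /=.
- by apply: (two (inl (t0, l)) top) => //=; apply: layer_le_refl.
- by apply: (two pendant (inr (inl None))).
Qed.

Let g_pendant : g pendant = pendant.
Proof.
apply: (@pendant_unique _ (g top)) => v; rewrite -(permKV g v) gadj nbr_pendant.
by rewrite (inj_eq perm_inj).
Qed.

Let g_top : g top = top.
Proof. by apply/eqP; rewrite -nbr_pendant -g_pendant gadj nbr_pendant. Qed.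

Let is_ref (v : colour_graph) : bool := if v is inr (inl _) then true else false.

Let g_ref v : is_ref (g v) = is_ref v.
Proof.
have refE w : is_ref w = (w != pendant) && cadj top w by case: w => [[x l]|[l|[]]].
by rewrite !refE -{1}g_pendant (inj_eq perm_inj) -{1}g_top gadj.
Qed.

(** The layer is read off from the number of adjacent references, which is its rank plus one, and
    [g] permutes the references. *)
Let g_layer x l : exists y, g (inl (x, l)) = inl (y, l).
Proof.
case Dv: (g (inl (x, l))) => [[y l']|[l'|[]]].
- exists y; congr (inl (_, _)); apply: enum_rank_inj; apply: val_inj.
  have nbr z m : #|[set v : colour_graph | is_ref v & cadj (inl (z, m)) v]| = (enum_rank m).+1.
    pose ref (i : 'I_(enum_rank m).+1) : colour_graph :=
      inr (inl (enum_val (widen_ord (ltn_ord (enum_rank m)) i))).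
    have ref_inj : injective ref.
      by move=> i j [] /enum_val_inj/(congr1 val)/= /val_inj.
    rewrite -[RHS]card_ord -(card_imset _ ref_inj); apply: eq_card => v; rewrite inE.
    apply/andP/imsetP=> [|[i _ ->]]; last first.
      by split=> //=; rewrite /layer_le enum_valK /= -ltnS.
    case: v => [u|[a|b]] [] // _; rewrite /= /layer_le -ltnS => lt_a.
    exists (Ordinal lt_a) => //; congr (inr (inl _)).
    by rewrite -[LHS]enum_rankK; congr enum_val; apply: val_inj.
  apply: succn_inj; rewrite -(nbr y) -(nbr x) -Dv.
  rewrite -[RHS](card_imset _ (@perm_inj _ g)); apply: eq_card => v.
  rewrite -(permKV g v) mem_imset; last exact: perm_inj.
  by rewrite !inE g_ref gadj.
- by have := g_ref (inl (x, l)); rewrite Dv.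
- by have /perm_inj := etrans Dv (esym g_top).
- by have /perm_inj := etrans Dv (esym g_pendant).
Qed.

(** A reference is determined by the layers it sees, and [g] preserves each layer. *)
Let g_refs l : g (inr (inl l)) = inr (inl l).
Proof.
have := g_ref (inr (inl l)); case Dl: (g _) => [|[l'|]] // _.
congr (inr (inl _)); apply: enum_rank_inj; apply: val_inj; apply/eqP.
have le m : layer_le l' m = layer_le l m.
  by have [y Dy] := g_layer t0 m; have := gadj (inr (inl l)) (inl (t0, m)); rewrite Dl Dy.
by rewrite eqn_leq; have := le l; have := le l'; rewrite /layer_le !leqnn => <- ->.
Qed.

(** The matchings with the copy [None] force [g] to act by the same [f] on all copies; the arcs then
    force [f] to preserve colours. *)
Lemma graph_lift_surj : exists2 f, f \in colour_aut & g = graph_lift f.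
Proof.
pose f x := if g (inl (x, None)) is inl (y, _) then y else x.
have gf x l : g (inl (x, l)) = inl (f x, l).
  have g0 : g (inl (x, None)) = inl (f x, None).
    by rewrite /f; have [y ->] := g_layer x None.
  case: l => // -[k b]; have [y Dy] := g_layer x (Some (k, b)).
  have := gadj (inl (x, None)) (inl (x, Some (k, b))).
  by rewrite g0 Dy /= eqxx => /eqP <-.
have f_inj : injective f.
  by move=> x y eqf; have := gf x None; rewrite eqf -gf => /perm_inj[].
exists (perm f_inj).
  apply/colour_autP=> x y; rewrite !permE.
  have := gadj (inl (x, Some (c x y, false))) (inl (y, Some (c x y, true))).
  by rewrite !gf /= !eqxx => /eqP.
apply/permP=> -[[x l]|[l|[]]]; rewrite ?liftE ?liftE' ?permE //.
Qed.

End Automorphism.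

Lemma colour_aut_isog : colour_aut \isog graph_aut colour_graph.
Proof.
have injL : 'injm graph_lift_morphism by apply/injmP=> f h _ _ /graph_lift_inj.
have -> : graph_aut colour_graph = graph_lift_morphism @* colour_aut.
  apply/eqP; rewrite eqEsubset; apply/andP; split; apply/subsetP=> g.
    case/graph_lift_surj=> f Af ->; apply: (@mem_morphim _ _ _ graph_lift_morphism) => //; exact: in_setT.
  by case/morphimP=> f _ Af ->; apply: graph_lift_aut.
by apply: sub_isog => //; apply: subsetT.
Qed.

Lemma stab_colour_graph (S : {set colour_graph}) :
  stab S = graph_lift @: 'C_colour_aut([set x | [exists l, inl (x, l) \in S]] | 'P).
Proof.
apply/setP=> g; apply/setIP/imsetP=> [[/graph_lift_surj[f Af ->] /astabP fixS]|].
  exists f => //; rewrite inE Af; apply/astabP=> x; rewrite inE => /existsP[l Sx].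
  by have := fixS _ Sx; rewrite /= apermE liftE => -[].
case=> f /setIP[Af /astabP fixS] ->; split; first exact: graph_lift_aut.
apply/astabP=> -[[x l]|v] Sv; rewrite /= apermE ?liftE ?liftE' //.
by rewrite -[f x]apermE (fixS x) // inE; apply/existsP; exists l.
Qed.

Lemma fixing_set_colour_graph (S : {set colour_graph}) :
  is_fixing_set S = ('C_colour_aut([set x | [exists l, inl (x, l) \in S]] | 'P) == 1).
Proof.
have lift1 : [set 1] = graph_lift @: [set 1].
  by rewrite imset_set1 (morph1 graph_lift_morphism).
rewrite /is_fixing_set stab_colour_graph -[X in _ == X]/[set 1] lift1.
exact: (inj_eq (imset_inj graph_lift_inj)).
Qed.

Lemma fixing_number_colour_graph n :
    (forall U : {set T}, 'C_colour_aut(U | 'P) = 1 -> n <= #|U|) ->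
    (exists2 U : {set T}, 'C_colour_aut(U | 'P) = 1 & #|U| <= n) ->
  fixing_number colour_graph = n.
Proof.
move=> lb [U CU leU]; have [[S fixS cardS] minS] := fixing_numberP colour_graph.
apply/eqP; rewrite eqn_leq; apply/andP; split.
  pose S' : {set colour_graph} := [set inl (x, None) | x in U].
  apply: leq_trans (leq_trans (minS S' _) (leq_imset_card _ _)) leU.
  rewrite fixing_set_colour_graph; apply/eqP; rewrite -CU; congr 'C_colour_aut(_ | 'P).
  apply/setP=> x; rewrite inE; apply/existsP/idP=> [[l /imsetP[y Uy [-> _]]] //|Ux].
  by exists None; apply: imset_f.
rewrite -cardS; rewrite fixing_set_colour_graph in fixS.
apply: leq_trans (lb _ (eqP fixS)) _.
(* The default [t0] is harmless: it can only enlarge the image, which still has at most #|S|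
   points. *)
pose pr (v : colour_graph) := if v is inl (x, _) then x else t0.
apply: leq_trans (leq_imset_card pr _); apply: subset_leq_card.
apply/subsetP=> x; rewrite inE => /existsP[l Sx].
by apply/imsetP; exists (inl (x, l)).
Qed.

End ColouringGraph.

Lemma prodgM_abelian (gT : finGroupType) (A : {group gT}) (I : Type) (r : seq I)
    (F G : I -> gT) :
    abelian A -> (forall i, F i \in A) -> (forall i, G i \in A) ->
  \prod_(i <- r) (F i * G i) = \prod_(i <- r) F i * \prod_(i <- r) G i.
Proof.
move=> abA AF AG; elim: r => [|i r IHr]; first by rewrite !big_nil mulg1.
have AP : \prod_(j <- r) F j \in A by apply: group_prod => j _.
rewrite !big_cons IHr -!mulgA; congr (_ * _); rewrite !mulgA; congr (_ * _).
exact: (centsP abA).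
Qed.

(** * Independent translations of n blocks *)

Section BlockTranslations.

Variables (gT : finGroupType) (Gamma : {group gT}) (n : nat) (K : 'I_n -> {group gT}).
Hypotheses (abG : abelian Gamma) (defG : \big[dprod/1]_(i < n) K i = Gamma).
Hypothesis ntK : forall i, K i :!=: 1.

Let T : finType := ('I_n * gT)%type.

(* The colour of a pair of points confines each point to its block and to its *)
(* coset of [K i], and fixes their difference when they share a block: the    *)
(* automorphisms are thus the independent translations of the blocks [i] by   *)
(* elements of [K i].                                                         *)
Definition block_colour (u v : T) : 'I_n * {set gT} * option gT :=
  (u.1, K u.1 :* u.2, if u.1 == v.1 then Some (u.2^-1 * v.2) else None).

Let A := colour_aut_group block_colour.

Let shift (f : {perm T}) i : gT := (f (i, 1)).2.

(** Preserving the difference from the point 1 of the block makes [f] a left translation there. *)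
Let shiftE f : f \in A -> forall i x, f (i, x) = (i, shift f i * x).
Proof.
move/colour_autP=> cf.
have f1 u : (f u).1 = u.1 by have [] := cf u u.
move=> i x; have [_ _] := cf (i, 1) (i, x); rewrite !f1 eqxx invg1 mul1g => -[eqx].
rewrite -[x in RHS]eqx mulKVg; have := f1 (i, x).
by case: (f (i, x)) => j y /= ->.
Qed.

Let shift_mem f i : f \in A -> shift f i \in K i.
Proof.
move=> Af; have /colour_autP/(_ (i, 1) (i, 1)) := Af.
rewrite shiftE //= mulg1 => -[eqK _].
by have := rcoset_refl (K i) (shift f i); rewrite eqK mulg1.
Qed.

Let sKG i : K i \subset Gamma.
Proof. by rewrite -(bigdprodWY defG) sub_gen // (bigcup_max i). Qed.

Let translation_fun (t : 'I_n -> gT) (u : T) : T := (u.1, t u.1 * u.2).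

Let translation_fun_inj t : injective (translation_fun t).
Proof. by move=> [i x] [j y] [/= <- /mulgI ->]. Qed.

Definition translation t : {perm T} := perm (@translation_fun_inj t).

Let translation_aut t : (forall i, t i \in K i) -> translation t \in A.
Proof.
move=> Kt; apply/colour_autP=> [[i x] [j y]].
rewrite !permE /block_colour /= rcosetM (rcoset_id (Kt i)) //.
by case: eqP => // <-; rewrite invMg -mulgA mulKg.
Qed.

Let prod_shift (f : {perm T}) : gT := \prod_(i < n) shift f i.

Let prod_shiftM : {in A &, {morph prod_shift : f h / f * h}}.
Proof.
move=> f h Af Ah; rewrite /prod_shift /= -(@prodgM_abelian _ Gamma) //.
- apply: eq_bigr => i _; rewrite /shift permM [f _]shiftE // shiftE //= mulg1.
  by apply: (centsP abG); apply/(subsetP (sKG i))/shift_mem.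
- by move=> i; apply/(subsetP (sKG i))/shift_mem.
- by move=> i; apply/(subsetP (sKG i))/shift_mem.
Qed.

Let prod_shift_morphism := Morphism prod_shiftM.

(** Multiplying the shifts of all blocks is a morphism as [Gamma] is abelian; existence and
    uniqueness of components in the direct product make it bijective. *)
Lemma block_colour_aut_isog : A \isog Gamma.
Proof.
have inj : 'injm prod_shift_morphism.
  apply/subsetP=> f /morphpreP[Af /set1P f1]; apply/set1P.
  have [e [_ _ uniq_e]] := mem_bigdprod defG (group1 _).
  apply/permP=> [[i x]]; rewrite perm1 shiftE //; congr (_, _).
  have e1 : 1 = e i by apply: (uniq_e (fun=> 1)); rewrite ?big1.
  rewrite (uniq_e _ _ (esym f1)) -?e1 ?mul1g // => j _; exact: shift_mem.
have -> : (Gamma : {set gT}) = prod_shift_morphism @* A; last exact: sub_isog.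
apply/eqP; rewrite eqEsubset; apply/andP; split; apply/subsetP=> x.
  move=> Gx; have [t [Kt -> _]] := mem_bigdprod defG Gx.
  have At : translation t \in A by apply: translation_aut => i; apply: Kt.
  apply/morphimP; exists (translation t) => //=.
  by apply: eq_bigr => i _; rewrite /shift permE /= mulg1.
case/morphimP=> f _ Af -> /=; apply: group_prod => i _.
exact/(subsetP (sKG i))/shift_mem.
Qed.

(** If [U] missed block i, translating that block alone by a nontrivial element of [K i] would fix
    [U]. *)
Lemma block_colour_base_ge (U : {set T}) : 'C_A(U | 'P) = 1 -> n <= #|U|.
Proof.
move=> CU; rewrite -[n]card_ord; apply: leq_trans (leq_imset_card fst U).
apply: subset_leq_card; apply/subsetP=> i _; apply: contraT => notUi.
have [k Kk ntk] := trivgPn _ (ntK i).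
pose t j := if j == i then k else 1.
have : translation t \in 'C_A(U | 'P).
  rewrite inE translation_aut => [|j]; last by rewrite /t; case: eqP => // ->.
  apply/astabP=> [[j x] Ujx]; rewrite /= apermE permE /translation_fun /t /=.
  by case: eqP => [ji|]; rewrite ?mul1g //; case/imsetP: notUi; exists (j, x).
rewrite CU => /set1P/permP/(_ (i, 1)); rewrite permE perm1 /translation_fun /t /=.
by rewrite eqxx mulg1 => -[k1]; rewrite k1 eqxx in ntk.
Qed.

Lemma block_colour_base : exists2 U : {set T}, 'C_A(U | 'P) = 1 & #|U| <= n.
Proof.
exists [set (i, 1) | i : 'I_n]; last first.
  by rewrite -[leqRHS]card_ord leq_imset_card.
apply/trivgP/subsetP=> f /setIP[Af /astabP fixU]; apply/set1P/permP=> [[i x]].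
rewrite perm1 shiftE // /shift -apermE fixU ?mul1g //; exact: imset_f.
Qed.

Lemma block_fixing_number : 0 < n -> in_group_fix Gamma n.
Proof.
move=> n_gt0; pose t0 : T := (Ordinal n_gt0, 1).
exists (colour_graph block_colour).
  apply: isog_trans block_colour_aut_isog.
  by rewrite isog_sym; apply: colour_aut_isog t0.
exact: (fixing_number_colour_graph t0 block_colour_base_ge block_colour_base).
Qed.

End BlockTranslations.

(** * Grouping the divisors into blocks *)

Lemma elementary_divisors_blocks (gT : finGroupType) (Gamma : {group gT}) s n :
    elementary_divisors Gamma s -> 0 < n <= size s ->
  exists2 K : 'I_n -> {group gT},
    \big[dprod/1]_(i < n) K i = Gamma & forall i, K i :!=: 1.
Proof.
case=> b [defG -> ppb]; case: n => // m; rewrite size_map /= => lt_m.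
have nt x : x \in b -> <[x]> != 1.
  move=> b_x; have [|p [a [p_pr a_gt0 ox]]] := ppb #[x]; first exact: map_f.
  by rewrite -cardG_gt1 -orderE ox -(exp1n a) ltn_exp2r ?prime_gt1.
move: defG; rewrite -{1}(cat_take_drop m b) big_cat /=.
set D := \big[_/_]_(x <- drop m b) _ => defG.
have [[_ H _ defH] _ _ _] := dprodP defG.
(* The first m = n - 1 cyclic factors stand alone; [H] gathers the rest, at least one since m is
   less than the length of [b]. *)
pose Ks := rcons [seq <[x]>%G | x <- take m b] H.
have szK : size Ks = m.+1 by rewrite size_rcons size_map size_takel // ltnW.
exists (fun i => nth H Ks i).
  rewrite -(big_mkord xpredT (fun i => nth H Ks i : {set gT})) -szK -(big_nth H xpredT).
  by rewrite /Ks -cats1 big_cat big_map big_seq1 -defH.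
move=> i; have: nth H Ks i \in Ks by rewrite mem_nth ?szK.
rewrite mem_rcons inE => /predU1P[-> | /mapP[x b_x ->]]; last first.
  exact/nt/mem_take/b_x.
move: defH; rewrite /D (drop_nth 1 lt_m) big_cons => /dprodP[[_ L _ ->] defH _ _].
apply: contraNneq (nt _ (mem_nth 1 lt_m)) => H1.
by rewrite -subG1 -H1 -defH mulG_subl.
Qed.

Theorem theorem14 (gT : finGroupType) (Gamma : {group gT}) (s : seq nat) :
  abelian Gamma -> Gamma :!=: 1%g -> elementary_divisors Gamma s ->
  forall n : nat, in_group_fix Gamma n <-> 1 <= n <= size s.
Proof.
move=> abG ntG Es n; split=> [[G isoG <-]|n_bounds].
  by rewrite (fixing_number_gt0 ntG isoG) (fixing_number_le Es isoG).
have [K defG ntK] := elementary_divisors_blocks Es n_bounds.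
by apply: block_fixing_number abG defG ntK _; case/andP: n_bounds.
Qed.
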